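(* Let $(\mathcal{J},\circ)$ be a Euclidean Jordan algebra and let $\mathcal{K}$ be its cone of squares, with generalized simplex $\Delta_{\mathcal{K}}=\{x\in\mathcal{K}:\operatorname{tr}(x)=1\}$. Let $\Phi_{\mathrm{ent}}(x)=\operatorname{tr}(x\circ\ln x)$ for $x\in\operatorname{int}(\mathcal{K})$, and let $D_{\Phi_{\mathrm{ent}}}(x,y)=\operatorname{tr}(x\circ\ln x-x\circ\ln y+y-x)$ for $x,y\in\operatorname{int}(\mathcal{K})$. Then for all $x,y\in\operatorname{int}(\Delta_{\mathcal{K}})$, $$D_{\Phi_{\mathrm{ent}}}(x,y)\;\ge\;\tfrac12\,\|x-y\|_{\operatorname{tr},1}^2 .$$
   Context: A Euclidean Jordan algebra (EJA) is a finite-dimensional real vector space $\mathcal{J}$ with a bilinear product $\circ$ satisfying $x\circ y=y\circ x$ and $x^2\circ(x\circ y)=x\circ(x^2\circ y)$ (where $x^2=x\circ x$), having an identity element $e$, and equipped with an inner product $(\cdot,\cdot)$ that is associative: $(x\circ y,z)=(y,x\circ z)$. Its cone of squares is $\mathcal{K}=\{x\circ x:x\in\mathcal{J}\}$. An idempotent is an element $p$ with $p\circ p=p$; it is primitive if it is nonzero and not a sum of two nonzero idempotents. A Jordan frame is a set $\{q_1,\dots,q_r\}$ of primitive idempotents with $q_i\circ q_j=0$ for $i\ne j$ and $\sum_i q_i=e$, where $r$ is the rank of $\mathcal{J}$ (the maximum over elements of the degree of the minimal polynomial). Every $x\in\mathcal{J}$ has a spectral decomposition $x=\sum_{i=1}^r\lambda_i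 q_i$ for some Jordan frame and real eigenvalues $\lambda_i$, uniquely determined with multiplicities. The trace is $\operatorname{tr}(x)=\sum_i\lambda_i$, and the trace-1 norm is $\|x\|_{\operatorname{tr},1}=\sum_i|\lambda_i|$. For $x=\sum_i\lambda_iq_i\in\operatorname{int}(\mathcal{K})$ (so all $\lambda_i>0$), $\ln x=\sum_i\ln(\lambda_i)q_i$. Here $\operatorname{int}(\Delta_{\mathcal{K}})$ denotes the relative interior $\Delta_{\mathcal{K}}\cap\operatorname{int}(\mathcal{K})$. *)

(* Defs.v *)
From HB Require Import structures.
From mathcomp Require Import all_boot all_order all_algebra.
From mathcomp Require Import all_classical all_reals all_analysis.
Set Implicit Arguments.
Unset Strict Implicit.
Unset Printing Implicit Defensive.
Import Order.TTheory GRing.Theory Num.Theory.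
Local Open Scope classical_set_scope.
Local Open Scope ring_scope.

(* The inner product is part of the structure; only its associativity, not any
   particular normalization, is required. *)
Record eja (R : realType) := Eja {
  eja_sort :> vectType R ;
  jmul : {bilinear eja_sort -> eja_sort -> eja_sort} ;
  jone : eja_sort ;
  jdot : {dot eja_sort for idfun} ;
  jmulC : forall x y, jmul x y = jmul y x ;
  jmul_jordan : forall x y,
    jmul (jmul x x) (jmul x y) = jmul x (jmul (jmul x x) y) ;
  jmul1x : forall x, jmul jone x = x ;
  jdot_assoc : forall x y z, jdot (jmul x y) z = jdot y (jmul x z)
}.

Reserved Notation "x ∘ y" (at level 40, left associativity).
Notation "x ∘ y" := (jmul _ x y) : ring_scope.

Section EuclideanJordanAlgebra.
Variables (R : realType) (J : eja R).
Implicit Types (x y p : J) (f : {poly R}).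

Definition jcone : set J := [set x ∘ x | x in setT].

(* Topological interior for the norm of the inner product; J being
   finite-dimensional, every norm gives the same interior. *)
Definition jinterior (A : set J) : set J :=
  [set x | exists2 eps : R, 0 < eps &
    forall y, Num.sqrt (jdot J (y - x) (y - x)) < eps -> A y].

Definition jpow x (n : nat) : J := iter n (jmul J x) (jone J).

Definition jhorner f x : J := \sum_(i < size f) f`_i *: jpow x i.

Definition is_minpoly x f :=
  [/\ f \is monic, jhorner f x = 0 &
      forall g : {poly R}, g \is monic -> jhorner g x = 0 ->
        (size f <= size g)%N].

Definition is_jrank (r : nat) :=
  (exists x f, is_minpoly x f /\ (size f).-1 = r) /\
  (forall x f, is_minpoly x f -> ((size f).-1 <= r)%N).

(* Since J is finite-dimensional, exactly one r satisfies is_jrank. *)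
Definition jrank : nat := xget 0%N [set r | is_jrank r].

Definition jidempotent p := p ∘ p = p.

Definition jprimitive p :=
  [/\ jidempotent p, p != 0 &
      ~ exists p1 p2 : J, [/\ jidempotent p1, jidempotent p2,
                              p1 != 0, p2 != 0 & p = p1 + p2]].

(* The members of such a family are automatically distinct: a repeated one
   would be p = p ∘ p = 0. *)
Definition jordan_frame (q : 'I_jrank -> J) :=
  [/\ forall i, jprimitive (q i),
      forall i j, i != j -> q i ∘ q j = 0 &
      \sum_i q i = jone J].

Definition is_spectral x (d : {ffun 'I_jrank -> R} * {ffun 'I_jrank -> J}) :=
  jordan_frame d.2 /\ x = \sum_i d.1 i *: d.2 i.

(* A chosen spectral decomposition of x. The default value is never used, by
   the spectral theorem, and since the eigenvalues are unique up to order and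
   the sum of the frame elements attached to each eigenvalue is unique,
   jtr, jnorm1 and jln below do not depend on the choice. *)
Definition jspectral x : {ffun 'I_jrank -> R} * {ffun 'I_jrank -> J} :=
  xget ([ffun=> 0], [ffun=> 0]) [set d | is_spectral x d].

Definition jeig x (i : 'I_jrank) : R := (jspectral x).1 i.
Definition jframe x (i : 'I_jrank) : J := (jspectral x).2 i.

Definition jtr x : R := \sum_i jeig x i.

Definition jnorm1 x : R := \sum_i `|jeig x i|.

(* Meaningful on the interior of jcone, where all eigenvalues are positive. *)
Definition jln x : J := \sum_i ln (jeig x i) *: jframe x i.

Definition jsimplex : set J := [set x | jcone x /\ jtr x = 1].

Definition jsimplex_int : set J := jsimplex `&` jinterior jcone.

Definition jentropy x : R := jtr (x ∘ jln x).

(* The Bregman divergence of jentropy. *)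
Definition jentropy_div x y : R :=
  jtr (x ∘ jln x - x ∘ jln y + y - x).

End EuclideanJordanAlgebra.

(* Main.v *)
(* Write x = sum_i x_i e_i and y = sum_j y_j f_j over Jordan frames, put
   B_ij = tr (e_i ∘ f_j) >= 0, and choose s with s ∘ s = e and
   N := ||x - y||_{tr,1} = tr (s ∘ (x - y)).  Then
     D(x, y) = sum_ij B_ij (x_i ln x_i - x_i ln y_j + y_j - x_i),
     N = sum_ij (x_i - y_j) tr ((s ∘ e_i) ∘ f_j).
   With the quadratic representation quad a z = 2 a ∘ (a ∘ z) - a^2 ∘ z, the form
   a |-> tr (quad a e_i ∘ f_j) is positive semidefinite: for f primitive,
   w = quad a f satisfies w ∘ w = k w with k >= 0.  Applying positivity to
   a = t s + ((x_i - y_j) / (x_i + 2 y_j)) e with weight x_i + 2 y_j, using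
     (a - b)^2 / (a + 2 b) <= (2 / 3) (a ln a - a ln b + b - a)
   and summing over i, j gives 3 t^2 + 2 t N + (2 / 3) D(x, y) >= 0 for all t; t = - N / 3
   is the claim.

   The given inner product need not be normalized.  Still, non-orthogonal primitive
   idempotents have equal norms, which yields both that all Jordan frames have the
   same size and that the trace is linear and associative. *)
Require Import Defs.
From mathcomp Require Import all_boot all_order all_algebra.
From mathcomp Require Import all_classical all_reals all_analysis.
From mathcomp Require Import complex.
From mathcomp Require Import ring lra.
Set Implicit Arguments.
Unset Strict Implicit.
Unset Printing Implicit Defensive.
Import Order.TTheory GRing.Theory Num.Theory.
Import ComplexField numFieldNormedType.Exports.
Local Open Scope classical_set_scope.
Local Open Scope ring_scope.

Local Notation "'[ x , y ]" := (jdot _ x y) : ring_scope.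

(** * The linearized Jordan identity *)

Section JordanIdentities.
Variables (R : realType) (J : eja R).
Implicit Types (x y z w e f p q u : J) (a b : R).

Lemma jmulDl x y z : (x + y) ∘ z = x ∘ z + y ∘ z.
Proof. exact: linearDl. Qed.
Lemma jmulDr x y z : z ∘ (x + y) = z ∘ x + z ∘ y.
Proof. exact: linearDr. Qed.
Lemma jmulNl x y : (- x) ∘ y = - (x ∘ y).
Proof. exact: linearNl. Qed.
Lemma jmulNr x y : y ∘ (- x) = - (y ∘ x).
Proof. exact: linearNr. Qed.
Lemma jmulZl a x y : (a *: x) ∘ y = a *: (x ∘ y).
Proof. exact: linearZl_LR. Qed.
Lemma jmulZr a x y : y ∘ (a *: x) = a *: (y ∘ x).
Proof. exact: linearZr_LR. Qed.
Lemma jmul0l x : 0 ∘ x = 0.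
Proof. exact: linear0l. Qed.
Lemma jmul0r x : x ∘ 0 = 0.
Proof. exact: linear0r. Qed.
Lemma jmulx1 x : x ∘ jone J = x.
Proof. by rewrite jmulC jmul1x. Qed.
Definition jmulE :=
  (jmulDl, jmulDr, jmulNl, jmulNr, jmulZl, jmulZr, jmul0l, jmul0r, jmul1x, jmulx1).

Lemma jdotDl x y z : '[x + y, z] = '[x, z] + '[y, z].
Proof. exact: linearDl. Qed.
Lemma jdotDr x y z : '[z, x + y] = '[z, x] + '[z, y].
Proof. exact: linearDr. Qed.
Lemma jdotNl x y : '[- x, y] = - '[x, y].
Proof. exact: linearNl. Qed.
Lemma jdotNr x y : '[y, - x] = - '[y, x].
Proof. exact: linearNr. Qed.
Lemma jdotZl a x y : '[a *: x, y] = a * '[x, y].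
Proof. exact: linearZl_LR. Qed.
Lemma jdotZr a x y : '[y, a *: x] = a * '[y, x].
Proof. exact: linearZr_LR. Qed.
Lemma jdot0l x : '[0, x] = 0.
Proof. exact: linear0l. Qed.
Lemma jdot0r x : '[x, 0] = 0.
Proof. exact: linear0r. Qed.
Definition jdotE :=
  (jdotDl, jdotDr, jdotNl, jdotNr, jdotZl, jdotZr, jdot0l, jdot0r).

Lemma jdotC x y : '[x, y] = '[y, x].
Proof. by rewrite hermC expr0 mul1r. Qed.

Lemma jdot_ge0 x : 0 <= '[x, x].
Proof.
have [->|x0] := eqVneq x 0; first by rewrite jdot0l.
exact/ltW/neq0_dnorm_gt0.
Qed.

Lemma jdot_gt0 x : x != 0 -> 0 < '[x, x].
Proof. exact: neq0_dnorm_gt0. Qed.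

Lemma jdot_eq0 x : '[x, x] = 0 -> x = 0.
Proof.
move=> xx0; apply/eqP/negPn/negP => /jdot_gt0.
by rewrite xx0 ltxx.
Qed.

Lemma jdot_inj x y : (forall v, '[x, v] = '[y, v]) -> x = y.
Proof.
move=> xy; apply/eqP; rewrite -subr_eq0; apply/eqP/jdot_eq0.
by rewrite jdotDl jdotNl xy subrr.
Qed.

Lemma jdot_self_adjoint x y z : '[x ∘ y, z] = '[y, x ∘ z].
Proof. exact: jdot_assoc. Qed.

(* All vector identities below are checked after pairing with an arbitrary
   vector, where [lra] treats the pairings as real atoms. *)
Lemma jordan_linearized x y z w :
  (x ∘ y) ∘ (z ∘ w) + (y ∘ z) ∘ (x ∘ w) + (z ∘ x) ∘ (y ∘ w) =
  x ∘ ((y ∘ z) ∘ w) + y ∘ ((z ∘ x) ∘ w) + z ∘ ((x ∘ y) ∘ w).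
Proof.
apply: jdot_inj => v.
have H s : '[s ∘ s ∘ (s ∘ w), v] = '[s ∘ (s ∘ s ∘ w), v].
  by rewrite jmul_jordan.
(* [H2] is the part of the Jordan identity linear in [z]: the difference of [H (s + z)] and
   [H (s - z)] keeps the odd part, and [H z] removes the cubic term. Polarizing in [s] then gives
   the claim. *)
have H2 s : '[(s ∘ z) ∘ (s ∘ w), v] *+ 2 + '[s ∘ s ∘ (z ∘ w), v] =
            '[s ∘ ((s ∘ z) ∘ w), v] *+ 2 + '[z ∘ (s ∘ s ∘ w), v].
  move: (H (s + z)) (H (s - z)) (H z).
  rewrite !jmulE !jdotE (jmulC z s); lra.
move: (H2 (x + y)) (H2 x) (H2 y).
rewrite !jmulE !jdotE (jmulC y x) (jmulC z x); lra.
Qed.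

End JordanIdentities.

(** * Idempotents *)

Section Peirce.
Variables (R : realType) (J : eja R).
Implicit Types (x y z w c e f p q u : J) (a b : R).

Section OneIdempotent.
Variable e : J.
Hypothesis ee : jidempotent e.

Lemma peirce_exchange z w :
  e ∘ (z ∘ w) + 2%:R *: ((e ∘ z) ∘ (e ∘ w)) =
  2%:R *: (e ∘ ((e ∘ z) ∘ w)) + z ∘ (e ∘ w).
Proof.
have := jordan_linearized e e z w; rewrite ee (jmulC z e) => h.
apply: jdot_inj => v; move: (congr1 (jdot J ^~ v) h).
rewrite !jdotE; lra.
Qed.

Lemma peirce0_mul z w : e ∘ z = 0 -> e ∘ (z ∘ w) = z ∘ (e ∘ w).
Proof.
by move=> ez; have := peirce_exchange z w; rewrite ez !jmulE !scaler0 addr0 add0r.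
Qed.

(** Multiplication by [e] has only the eigenvalues 0, 1/2 and 1; this excludes a 1/2-component in
    the square of an element of the 1/2-space. *)
Lemma peirce_half_sqr u :
  e ∘ u = 2^-1 *: u -> e ∘ (e ∘ (u ∘ u)) = e ∘ (u ∘ u).
Proof.
move=> eu; have := jordan_linearized u u e e.
rewrite ee (jmulC u e) eu !jmulE (jmulC u e) eu !jmulE (jmulC (u ∘ u)).
move=> h; apply: jdot_inj => v; move: (congr1 (jdot J ^~ v) h).
rewrite !jdotE; lra.
Qed.

(** Multiplication by [e], called L, satisfies 2 L^3 - 3 L^2 + L = 0, with roots 0, 1/2 and 1. The
    witnesses are the Lagrange projections 2 L^2 - L, 4 L - 4 L^2 and 1 - 3 L + 2 L^2 applied to
    [z]. *)
Lemma peirce_decomposition z : exists z1 zh z0,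
  [/\ z = z1 + zh + z0, e ∘ z1 = z1, e ∘ zh = 2^-1 *: zh & e ∘ z0 = 0].
Proof.
have h : 2%:R *: (e ∘ (e ∘ (e ∘ z))) = 3%:R *: (e ∘ (e ∘ z)) - e ∘ z.
  apply: jdot_inj => v; have := congr1 (jdot J ^~ v) (peirce_exchange z e).
  rewrite ee !(jmulC _ e) !jdotE; lra.
have {}h : e ∘ (e ∘ (e ∘ z)) = (3 / 2) *: (e ∘ (e ∘ z)) - 2^-1 *: (e ∘ z).
  apply: jdot_inj => v; have := congr1 (jdot J ^~ v) h.
  rewrite !jdotE; lra.
exists (2%:R *: (e ∘ (e ∘ z)) - e ∘ z), (4%:R *: (e ∘ z) - 4%:R *: (e ∘ (e ∘ z))),
  (z - 3%:R *: (e ∘ z) + 2%:R *: (e ∘ (e ∘ z))).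
by split; apply: jdot_inj => v; rewrite ?jmulE ?h !jdotE; lra.
Qed.

(** Distinct Peirce spaces are orthogonal because multiplication by [e] is self-adjoint. The formula
    yields both the nonnegativity of the form and its null vectors. *)
Lemma idempotent_form z : exists z1 zh z0,
  [/\ z = z1 + zh + z0, e ∘ z = z1 + 2^-1 *: zh &
      '[e ∘ z, z] = '[z1, z1] + 2^-1 * '[zh, zh]].
Proof.
have [z1 [zh [z0 [-> e1 eh e0]]]] := peirce_decomposition z.
exists z1, zh, z0; rewrite !jmulE e1 eh e0 addr0; split=> //.
move: (jdot_self_adjoint e z1 zh) (jdot_self_adjoint e z1 z0) (jdot_self_adjoint e zh z0).
rewrite e1 eh e0 !jdotE (jdotC zh z1); lra.
Qed.

Lemma idempotent_form_ge0 z : 0 <= '[e ∘ z, z].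
Proof.
have [z1 [zh [z0 [_ _ ->]]]] := idempotent_form z.
have := jdot_ge0 z1; have := jdot_ge0 zh; lra.
Qed.

Lemma idempotent_form_eq0 z : '[e ∘ z, z] = 0 -> e ∘ z = 0.
Proof.
have [z1 [zh [z0 [_ -> ->]]]] := idempotent_form z => h.
have h1 := jdot_ge0 z1; have hh := jdot_ge0 zh.
have /jdot_eq0-> : '[z1, z1] = 0 by lra.
have /jdot_eq0-> : '[zh, zh] = 0 by lra.
by rewrite scaler0 addr0.
Qed.

Lemma idempotent_dot_sqr_ge0 z : 0 <= '[e, z ∘ z].
Proof. by rewrite -jdot_self_adjoint jmulC idempotent_form_ge0. Qed.

Lemma idempotent_dot_self : '[e, e] = '[e, jone J].
Proof. by have := jdot_self_adjoint e e (jone J); rewrite ee jmulx1. Qed.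

End OneIdempotent.

Lemma idempotent_dot_ge0 p q : jidempotent p -> jidempotent q -> 0 <= '[p, q].
Proof. by move=> pp <-; apply: idempotent_dot_sqr_ge0. Qed.

(** Since ['[p, q] = '[p ∘ q, q]], the form of [p] vanishes at [q]. *)
Lemma idempotent_dot_eq0 p q :
  jidempotent p -> jidempotent q -> '[p, q] = 0 -> p ∘ q = 0.
Proof.
move=> pp qq pq; apply: (idempotent_form_eq0 pp).
by rewrite jmulC jdot_self_adjoint qq.
Qed.

Lemma idempotent1 : jidempotent (jone J).
Proof. exact: jmul1x. Qed.

Lemma jmul_suml (I : Type) (r : seq I) (P : pred I) (F : I -> J) y :
  (\sum_(i <- r | P i) F i) ∘ y = \sum_(i <- r | P i) F i ∘ y.
Proof. exact: linear_sumlz. Qed.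
Lemma jmul_sumr (I : Type) (r : seq I) (P : pred I) (F : I -> J) y :
  y ∘ (\sum_(i <- r | P i) F i) = \sum_(i <- r | P i) y ∘ F i.
Proof. exact: linear_sumr. Qed.
Lemma jdot_suml (I : Type) (r : seq I) (P : pred I) (F : I -> J) y :
  '[\sum_(i <- r | P i) F i, y] = \sum_(i <- r | P i) '[F i, y].
Proof. exact: linear_sumlz. Qed.
Lemma jdot_sumr (I : Type) (r : seq I) (P : pred I) (F : I -> J) y :
  '[y, \sum_(i <- r | P i) F i] = \sum_(i <- r | P i) '[y, F i].
Proof. exact: linear_sumr. Qed.

(* Since |q|^2 = '[q, 1] for an idempotent, the squared norm of the sum is
   already exhausted by the diagonal terms. *)
Lemma idempotent_sum_orthogonal (I : finType) (q : I -> J) c :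
  (forall i, jidempotent (q i)) -> jidempotent c -> \sum_i q i = c ->
  forall i j, i != j -> q i ∘ q j = 0.
Proof.
move=> qq cc qc i j ij; apply: idempotent_dot_eq0 => //.
have h : \sum_i \sum_(j | j != i) '[q i, q j] = 0.
  have E k : \sum_(j | j != k) '[q k, q j] = '[q k, c] - '[q k, q k].
    by rewrite -qc jdot_sumr [X in _ = X - _](bigD1 k)//= addrAC subrr add0r.
  under eq_bigr do rewrite E idempotent_dot_self//.
  rewrite sumrB -!jdot_suml qc idempotent_dot_self// subrr //.
have ge0 k l : 0 <= '[q k, q l] by exact: idempotent_dot_ge0.
move/eqP: h; rewrite psumr_eq0 => [|k _]; last exact: sumr_ge0.
move=> /allP /(_ i (mem_index_enum _)) /=.
rewrite psumr_eq0 // => /allP /(_ j (mem_index_enum _)).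
by rewrite eq_sym ij => /eqP.
Qed.

End Peirce.

(** * Power associativity *)

Section PowerAssociativity.
Variables (R : realType) (J : eja R).
Implicit Types (x y z w : J) (n m : nat) (g h : {poly R}).

(** Exchanging [z] and [w] leaves the left side of [jordan_linearized] unchanged. Equating the two
    right sides expresses multiplication by a triple product through shorter products. *)
Lemma jmul_triple x y z w :
  ((x ∘ y) ∘ z) ∘ w =
  x ∘ ((y ∘ z) ∘ w) + y ∘ ((z ∘ x) ∘ w) + z ∘ ((x ∘ y) ∘ w)
  - x ∘ ((y ∘ w) ∘ z) - y ∘ ((w ∘ x) ∘ z).
Proof.
have h1 := jordan_linearized x y z w; have h2 := jordan_linearized x y w z.
apply: jdot_inj => v.
move: (congr1 (jdot J ^~ v) h1) (congr1 (jdot J ^~ v) h2).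
rewrite (jmulC w z) (jmulC z x) (jmulC w x) (jmulC (y ∘ z)) (jmulC (x ∘ y ∘ z)).
rewrite (jmulC (y ∘ w) (x ∘ z)) !jdotE; lra.
Qed.

Lemma jpowS x n : jpow x n.+1 = x ∘ jpow x n.
Proof. by []. Qed.

Lemma jpow_mul_comm x n w : jpow x n ∘ (x ∘ w) = x ∘ (jpow x n ∘ w).
Proof.
(* The recursion [E] expresses multiplication by a power through the two preceding powers, [x] and
   [x ∘ x], so the induction carries two consecutive powers and commutation with both operators. *)
suff: (forall w, jpow x n ∘ (x ∘ w) = x ∘ (jpow x n ∘ w) /\
        jpow x n ∘ (x ∘ x ∘ w) = x ∘ x ∘ (jpow x n ∘ w)) /\
      (forall w, jpow x n.+1 ∘ (x ∘ w) = x ∘ (jpow x n.+1 ∘ w) /\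
        jpow x n.+1 ∘ (x ∘ x ∘ w) = x ∘ x ∘ (jpow x n.+1 ∘ w)).
  by move=> [/(_ w)[]].
elim: n {w} => [|n [ih0 ih1]].
  by split=> w; rewrite /jpow /= ?jmulE ?jmul_jordan.
split=> // w.
have E v : jpow x n.+2 ∘ v = jpow x n ∘ (x ∘ x ∘ v) + 2%:R *: (x ∘ (jpow x n.+1 ∘ v))
   - jpow x n ∘ (x ∘ (x ∘ v)) - x ∘ (x ∘ (jpow x n ∘ v)).
  have := jmul_triple (jpow x n) x x v.
  rewrite -jpowS (jmulC (jpow x n) x) -jpowS (jmulC _ x) -jpowS => ->.
  rewrite (jmulC v (jpow x n)) (jmulC _ x) scaler_nat mulr2n.
  by rewrite (jmulC (jpow x n ∘ v) x) !addrA.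
have c0 v : jpow x n ∘ (x ∘ v) = x ∘ (jpow x n ∘ v) by case: (ih0 v).
have c1 v : jpow x n.+1 ∘ (x ∘ v) = x ∘ (jpow x n.+1 ∘ v) by case: (ih1 v).
have d0 v : jpow x n ∘ (x ∘ x ∘ v) = x ∘ x ∘ (jpow x n ∘ v) by case: (ih0 v).
have d1 v : jpow x n.+1 ∘ (x ∘ x ∘ v) = x ∘ x ∘ (jpow x n.+1 ∘ v).
  by case: (ih1 v).
by rewrite !E !jmulE !(c0, c1, d0, d1, jmul_jordan).
Qed.

Lemma jpowD x m n : jpow x m ∘ jpow x n = jpow x (m + n).
Proof.
elim: m => [|m ih]; first by rewrite add0n jmul1x.
by rewrite addSn !jpowS jmulC jpow_mul_comm (jmulC (jpow x n)) ih.
Qed.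

Lemma jhorner_wide g x n : (size g <= n)%N ->
  jhorner g x = \sum_(i < n) g`_i *: jpow x i.
Proof.
move=> gn; rewrite /jhorner (big_ord_widen n (fun i => g`_i *: jpow x i))//.
rewrite big_mkcond; apply: eq_bigr => i _.
by case: ltnP => // gi; rewrite nth_default// scale0r.
Qed.

Lemma jhornerD x g h : jhorner (g + h) x = jhorner g x + jhorner h x.
Proof.
pose n := maxn (size g) (size h).
rewrite !(@jhorner_wide _ _ n) ?leq_maxl ?leq_maxr ?size_polyD// -big_split /=.
by apply: eq_bigr => i _; rewrite coefD scalerDl.
Qed.

Lemma jhornerZ x a g : jhorner (a *: g) x = a *: jhorner g x.
Proof.
rewrite !(@jhorner_wide _ _ (size g)) ?size_scale_leq// scaler_sumr.
by apply: eq_bigr => i _; rewrite coefZ scalerA.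
Qed.

Lemma jhorner_sum x (I : Type) (r : seq I) (F : I -> {poly R}) :
  jhorner (\sum_(i <- r) F i) x = \sum_(i <- r) jhorner (F i) x.
Proof.
elim/big_rec2: _ => [|i y1 y2 _ <-]; last exact: jhornerD.
by rewrite /jhorner size_poly0 big_ord0.
Qed.

Lemma jhornerXn x n : jhorner 'X^n x = jpow x n.
Proof.
rewrite /jhorner size_polyXn (bigD1 ord_max)//= coefXn eqxx scale1r big1 ?addr0//.
by move=> i /negbTE ni; rewrite coefXn -val_eqE /= in ni *; rewrite ni scale0r.
Qed.

Lemma jhornerM x g h : jhorner (g * h) x = jhorner g x ∘ jhorner h x.
Proof.
rewrite -[g in LHS]coefK poly_def mulr_suml jhorner_sum {2}/jhorner jmul_suml.
apply: eq_bigr => i _; rewrite -scalerAl jhornerZ jmulZl; congr (_ *: _).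
rewrite -[h in LHS]coefK poly_def mulr_sumr jhorner_sum {2}/jhorner jmul_sumr.
apply: eq_bigr => j _; rewrite -scalerAr jhornerZ jmulZr; congr (_ *: _).
by rewrite -exprD jhornerXn jpowD.
Qed.

Lemma jhornerX x : jhorner 'X x = x.
Proof. by rewrite -(expr1 'X) jhornerXn jpowS /jpow /= jmulx1. Qed.

Lemma jhorner1 x : jhorner 1 x = jone J.
Proof. by rewrite -(expr0 'X) jhornerXn. Qed.

End PowerAssociativity.

(** * Real roots and functional calculus *)

Section RealRoots.
Variable R : realType.

(* In the second case, a + ib is a complex root of f. *)
Lemma real_poly_factor (f : {poly R}) : (1 < size f)%N ->
  (exists a, root f a) \/
  (exists a b, b != 0 /\ ('X - a%:P) ^+ 2 + (b ^+ 2)%:P %| f).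
Proof.
move=> f1.
have : size (map_poly (real_complex R) f) != 1.
  by rewrite size_map_poly; case: size f1 => [|[]].
case/closed_rootP => -[a b] fz.
have [b0|b0] := eqVneq b 0.
  left; exists a; move: fz; rewrite b0 => /eqP.
  by rewrite -[(a +i* 0)%C]/(real_complex R a) horner_map => /eqP; rewrite fmorph_eq0.
right; exists a, b; split=> //.
set q := _ + _.
have qs : size q = 3%N.
  rewrite /q size_polyDl size_exp_XsubC //.
  by rewrite (leq_ltn_trans (size_polyC_leq1 _)).
have q0 : q != 0 by rewrite -size_poly_eq0 qs.
have qz : (map_poly (real_complex R) q).[(a +i* b)%C] = 0.
  rewrite rmorphD rmorphXn /= rmorphB /= map_polyX !map_polyC /= !hornerE /=.
  apply/eqP; rewrite eq_complex /=; apply/andP; split; apply/eqP; ring.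
have : (map_poly (real_complex R) (f %% q)).[(a +i* b)%C] = 0.
  move/eqP: fz; rewrite [in map_poly _ f](divp_eq f q) rmorphD rmorphM /= hornerD hornerM qz.
  by rewrite mulr0 add0r.
(* The remainder has degree at most one and vanishes at a + ib: the imaginary part b r_1 gives r_1 =
   0, and then the real part gives r_0 = 0. *)
have rs : (size (f %% q)%R <= 2)%N by rewrite -ltnS -qs ltn_modp.
rewrite /dvdp; move: rs; set r := f %% q => rs.
rewrite (@horner_coef_wide _ 2) ?size_map_poly// big_ord_recl big_ord1 /=.
rewrite !coef_map /= => /eqP; rewrite eq_complex /= => /andP[/eqP h1 /eqP h2].
have r1 : r`_1 = 0.
  by apply: (mulIf b0); move: h2; rewrite /bump /=; lra.
have r0 : r`_0 = 0 by move: h1; rewrite /bump /= r1; lra.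
apply/eqP/polyP => -[|[|i]]; rewrite coef0 //.
by rewrite nth_default// (leq_trans rs).
Qed.

End RealRoots.

Section FunctionalCalculus.
Variables (R : realType) (J : eja R).
Implicit Types (x y z w : J) (n m : nat) (f g h : {poly R}).

Lemma jsqr_dot1 w : '[w ∘ w, jone J] = '[w, w].
Proof. by rewrite jdot_self_adjoint jmulx1. Qed.

Lemma jsqr_eq0 w : w ∘ w = 0 -> w = 0.
Proof. by move=> w0; apply: jdot_eq0; rewrite -jsqr_dot1 w0 jdot0l. Qed.

Lemma jhorner_sqr_free x g h : jhorner (g * g * h) x = 0 -> jhorner (g * h) x = 0.
Proof.
move=> e; apply: jsqr_eq0; rewrite -jhornerM.
by rewrite (_ : g * h * (g * h) = g * g * h * h); [rewrite jhornerM e jmul0l|ring].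
Qed.

(** With w = (x - a) h(x) and v = h(x), the hypothesis times h(x) reads w^2 + b^2 v^2 = 0; pairing
    with the identity turns this into |w|^2 + b^2 |v|^2 = 0. *)
Lemma jhorner_positive_quadratic x a b h : b != 0 ->
  jhorner ((('X - a%:P) ^+ 2 + (b ^+ 2)%:P) * h) x = 0 -> jhorner h x = 0.
Proof.
move=> b0 e; apply: jdot_eq0.
set w := jhorner (('X - a%:P) * h) x; set v := jhorner h x.
have : w ∘ w + b ^+ 2 *: (v ∘ v) = 0.
  rewrite -!jhornerM -jhornerZ -jhornerD -mul_polyC.
  rewrite (_ : _ + _ = (('X - a%:P) ^+ 2 + (b ^+ 2)%:P) * h * h); last by ring.
  by rewrite jhornerM e jmul0l.
move=> /(congr1 (jdot J ^~ (jone J))); rewrite !jdotE !jsqr_dot1 => /eqP.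
have b2 : 0 < b ^+ 2 by rewrite exprn_even_gt0.
rewrite paddr_eq0 ?(mulr_ge0 (ltW b2)) ?jdot_ge0// => /andP[_].
by rewrite mulf_eq0 gt_eqF//= => /eqP.
Qed.

Lemma jhorner_annihilator x : exists2 f, f != 0 & jhorner f x = 0.
Proof.
pose n := (\dim {:J}).+1.
pose X := [tuple jpow x i | i < n].
have : ~~ free X.
  rewrite /free neq_ltn; apply/orP; left.
  by rewrite size_tuple ltnS dimvS// subvf.
move=> /freeP h; apply: contrapT => nf; apply: h => k k0 i.
apply: contrapT => /eqP ki; apply: nf.
pose f := \poly_(j < n) (if insub j is Some j' then k j' else 0).
have fE (j : 'I_n) : f`_j = k j by rewrite coef_poly ltn_ord valK.
exists f; first by apply: contraNneq ki => f0; rewrite -fE f0 coef0.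
rewrite (@jhorner_wide _ _ _ _ n) ?size_poly// -[RHS]k0.
by apply: eq_bigr => j _; rewrite fE -tnth_nth tnth_mktuple.
Qed.

(** The factors of an annihilating polynomial are stripped from [f] one at a time: a new root joins
    [s], a repeated root is dropped by [jhorner_sqr_free], a quadratic without real roots by
    [jhorner_positive_quadratic]. *)
Lemma jhorner_split x :
  exists2 s : seq R, uniq s & jhorner (\prod_(a <- s) ('X - a%:P)) x = 0.
Proof.
suff H n : forall f s, (size f <= n)%N -> f != 0 -> uniq s ->
    jhorner (f * \prod_(a <- s) ('X - a%:P)) x = 0 ->
    exists2 s : seq R, uniq s & jhorner (\prod_(a <- s) ('X - a%:P)) x = 0.
  have [f f0 fx] := jhorner_annihilator x.
  by apply: (H _ f [::]) => //; rewrite big_nil mulr1.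
elim: n => [|n ih] f s fn f0 us fx.
  by move: f0; rewrite -size_poly_leq0 fn.
have [f1|f1] := leqP (size f) 1.
  exists s => //; move: fx f0; rewrite (size1_polyC f1) mul_polyC jhornerZ polyC_eq0.
  by move=> /eqP; rewrite scaler_eq0 => /orP[/eqP->|/eqP //]; rewrite eqxx.
have [[a /factor_theorem[g fE]]|[a [b [b0 /dvdpP[g fE]]]]] := real_poly_factor f1.
  have g0 : g != 0 by apply: contraNneq f0; rewrite fE => ->; rewrite mul0r.
  have gn : (size g <= n)%N.
    by move: fn; rewrite fE size_Mmonic ?monicXsubC// size_XsubC addn2.
  have [as_|as_] := boolP (a \in s); last first.
    apply: (ih g (a :: s)) => //=; first by rewrite as_.
    by rewrite big_cons mulrA -fE.
  apply: (ih g s) => //; move: fx; rewrite fE (big_rem a)//=.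
  set p := \prod_(_ <- _) _ => fx.
  rewrite (_ : g * _ = ('X - a%:P) * (g * p)); last by ring.
  apply: jhorner_sqr_free; rewrite -[RHS]fx; congr (jhorner _ x); ring.
have g0 : g != 0 by apply: contraNneq f0; rewrite fE => ->; rewrite mul0r.
apply: (ih g s) => //; last first.
  apply: (@jhorner_positive_quadratic _ a b) => //.
  by rewrite mulrA -[_ * g]mulrC -fE.
move: fn; rewrite fE size_Mmonic //; last first.
  rewrite monicE lead_coefDl ?lead_coef_exp ?lead_coefXsubC ?expr1n//.
  by rewrite size_exp_XsubC (leq_ltn_trans (size_polyC_leq1 _)).
rewrite size_polyDl size_exp_XsubC; first by rewrite addn3 => /ltnW.
by rewrite (leq_ltn_trans (size_polyC_leq1 _)).
Qed.

Lemma jhorner_eq_on x (s : seq R) g h : uniq s ->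
  jhorner (\prod_(a <- s) ('X - a%:P)) x = 0 ->
  {in s, forall a, g.[a] = h.[a]} -> jhorner g x = jhorner h x.
Proof.
move=> us sx gh; apply/eqP; rewrite -subr_eq0 -scaleN1r -jhornerZ -jhornerD scaleN1r.
have /dvdpP[k ->] : \prod_(a <- s) ('X - a%:P) %| g - h.
  apply: uniq_roots_dvdp; rewrite ?uniq_rootsE//.
  by apply/allP => a /gh e; rewrite rootE hornerD hornerN e subrr.
by rewrite jhornerM sx jmul0r.
Qed.

(* The idempotents are the Lagrange interpolation polynomials at the eigenvalues,
   evaluated at x. *)
Lemma idempotent_decomposition x : exists s : seq (R * J),
  [/\ all (fun c => c.2 != 0) s, {in s, forall c, jidempotent c.2},
      \sum_(c <- s) c.2 = jone J & x = \sum_(c <- s) c.1 *: c.2].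
Proof.
have [s us sx] := jhorner_split x.
pose l (a : R) : {poly R} := \prod_(b <- rem a s) ((a - b)^-1 *: ('X - b%:P)).
have lE a b : a \in s -> b \in s -> (l a).[b] = (a == b)%:R.
  move=> ia ib; rewrite /l horner_prod; case: eqVneq => [<-|ab].
    rewrite big_seq big1// => c; rewrite mem_rem_uniq// inE => /andP[ca _].
    by rewrite !hornerE mulVf// subr_eq0 eq_sym.
  rewrite (big_rem b) /= ?mem_rem_uniq ?inE 1?eq_sym ?ab//.
  by rewrite !hornerE subrr mulr0 mul0r.
have sumE (F : R -> R) b : b \in s -> \sum_(a <- s) F a * (l a).[b] = F b.
  move=> ib; rewrite (big_rem b)//= lE// eqxx mulr1 big_seq big1 ?addr0// => c.
  rewrite mem_rem_uniq// inE => /andP[cb cs].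
  by rewrite lE// (negbTE cb) mulr0.
pose t := [seq (a, jhorner (l a) x) | a <- s].
(* The elements of [s] are roots of an annihilating polynomial that need not be minimal, so some of
   the idempotents may be zero and are removed. *)
exists [seq c <- t | c.2 != 0]; split.
- exact: filter_all.
- move=> c; rewrite mem_filter => /andP[_ /mapP[a ia ->]] /=.
  rewrite /jidempotent -jhornerM; apply: (jhorner_eq_on us sx) => b ib.
  by rewrite hornerM !lE//; case: eqP; rewrite ?mulr1 ?mulr0.
- rewrite big_filter big_mkcond (eq_bigr snd); last by move=> c _; case: eqP => [->|].
  rewrite big_map /= -jhorner_sum -(jhorner1 x).
  apply: (jhorner_eq_on us sx) => b ib.
  rewrite horner_sum hornerE -[RHS](sumE (fun=> 1) b ib).
  by apply: eq_bigr => a _; rewrite mul1r.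
- rewrite big_filter big_mkcond (eq_bigr (fun c => c.1 *: c.2)); last first.
    by move=> c _; case: eqP => [->|]; rewrite ?scaler0.
  rewrite big_map /=; under eq_bigr do rewrite -jhornerZ.
  rewrite -jhorner_sum -[LHS]jhornerX.
  apply: (jhorner_eq_on us sx) => b ib.
  rewrite horner_sum hornerX -[LHS](sumE id b ib).
  by apply: eq_bigr => a _; rewrite hornerZ.
Qed.

End FunctionalCalculus.

(** * Frames of primitive idempotents *)

Section Frames.
Variables (R : realType) (J : eja R).
Implicit Types (x y z w p q e f g a u : J) (n m : nat) (k : R).

Definition frame n (q : 'I_n -> J) :=
  [/\ forall i, jprimitive (q i), forall i j, i != j -> q i ∘ q j = 0 &
      \sum_i q i = jone J].

Lemma primitive_idempotent p : jprimitive p -> jidempotent p.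
Proof. by case. Qed.

Lemma primitive_dot_gt0 p : jprimitive p -> 0 < '[p, p].
Proof. by case=> _ p0 _; apply: jdot_gt0. Qed.

Lemma orthogonal_family_mul n (k : 'I_n -> R) (q : 'I_n -> J) j :
  (forall i, jidempotent (q i)) -> (forall i j, i != j -> q i ∘ q j = 0) ->
  q j ∘ (\sum_i k i *: q i) = k j *: q j.
Proof.
move=> qq qo; rewrite jmul_sumr (bigD1 j)//= jmulZr qq big1 ?addr0// => i ij.
by rewrite jmulZr qo 1?eq_sym// scaler0.
Qed.

Lemma idempotent_family_le_dim n (q : 'I_n -> J) :
  (forall i, jidempotent (q i)) -> (forall i, q i != 0) ->
  \sum_i q i = jone J -> (n <= \dim {:J})%N.
Proof.
move=> qq q0 q1; have qo := idempotent_sum_orthogonal qq (@idempotent1 _ J) q1.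
pose X := [tuple q i | i < n].
suff fX : free X.
  by have := dimvS (subvf <<X>>%VS); rewrite (eqP fX) size_tuple.
apply/freeP => k k0 j; have := orthogonal_family_mul k j qq qo.
rewrite (_ : \sum_i _ = 0) ?jmul0r; last first.
  by rewrite -[RHS]k0; apply: eq_bigr => i _; rewrite -tnth_nth tnth_mktuple.
by move/esym/eqP; rewrite scaler_eq0 (negbTE (q0 j)) orbF => /eqP.
Qed.

(* A decomposition with the largest number of idempotents cannot be refined, so
   its members are primitive. *)
Lemma spectral_theorem x : exists n (k : 'I_n -> R) (q : 'I_n -> J),
  frame q /\ x = \sum_i k i *: q i.
Proof.
pose D s := [/\ all (fun c : R * J => c.2 != 0) s, {in s, forall c, jidempotent c.2},
  \sum_(c <- s) c.2 = jone J & x = \sum_(c <- s) c.1 *: c.2].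
pose k s (i : 'I_(size s)) : R := (nth (0, 0 : J) s i).1.
pose q s (i : 'I_(size s)) : J := (nth (0 : R, 0) s i).2.
have DE s : D s -> [/\ forall i, jidempotent (q s i), forall i, q s i != 0,
    \sum_i q s i = jone J & x = \sum_i k s i *: q s i].
  move=> [s0 si s1 sx]; split=> [i|i||].
  - exact/si/mem_nth.
  - exact/(allP s0)/mem_nth.
  - by rewrite -s1 (big_nth (0, 0)) big_mkord.
  - by rewrite {1}sx (big_nth (0, 0)) big_mkord.
pose P n := `[< exists2 s, D s & size s = n >].
have exP : exists n, P n.
  by have [s Ds] := idempotent_decomposition x; exists (size s); apply/asboolP; exists s.
have leP n : P n -> (n <= \dim {:J})%N.
  by move=> /asboolP[s /DE[h1 h2 h3 _] <-]; apply: idempotent_family_le_dim h1 h2 h3.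
case: (ex_maxnP exP leP) => n /asboolP[s Ds sn] nmax.
have [qi q0 q1 qx] := DE _ Ds.
exists (size s), (k s), (q s); split=> //; split=> // [i|]; last first.
  exact: idempotent_sum_orthogonal (@idempotent1 _ J) q1.
split=> // -[p1 [p2 [i1 i2 n1 n2 e]]].
set c := nth (0 : R, 0 : J) s i; have cs : c \in s by exact: mem_nth.
case: Ds => s0 si s1 sx.
have ce : c.2 = p1 + p2 by exact: e.
suff : (n.+1 <= n)%N by rewrite ltnn.
apply/nmax/asboolP; exists [:: (c.1, p1), (c.1, p2) & rem c s]; last first.
  by rewrite /= size_rem// sn prednK// -sn; case: (s) cs.
split => /=.
- by rewrite n1 n2; apply/allP => d /mem_rem; exact: (allP s0).
- by move=> d; rewrite !inE => /or3P[/eqP->|/eqP->|/mem_rem/si].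
- by rewrite !big_cons /= addrA -ce -s1 [RHS](big_rem c).
- rewrite !big_cons /= addrA -scalerDr -ce.
  by rewrite {1}sx (big_rem c).
Qed.

Lemma idempotentC p : jidempotent p -> jidempotent (jone J - p).
Proof.
by move=> pp; rewrite /jidempotent !jmulE pp; apply: jdot_inj => v; rewrite !jdotE; ring.
Qed.

(** In a spectral decomposition of [x], each [q i] with nonzero coefficient satisfies
    [f ∘ q i = q i]; then [f - q i] is idempotent and primitivity forces [q i = f]. *)
Lemma primitive_line f x : jprimitive f -> f ∘ x = x -> exists k, x = k *: f.
Proof.
move=> [ff f0 fprim] fx; have [n [k [q [[qp qo q1] xE]]]] := spectral_theorem x.
have qq i := primitive_idempotent (qp i).
have x2 : x ∘ x = \sum_i k i ^+ 2 *: q i.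
  rewrite {1}xE jmul_suml; apply: eq_bigr => i _.
  by rewrite jmulZl {1}xE orthogonal_family_mul// scalerA expr2.
(* Passing to the square makes all coefficients nonnegative, so this pairing vanishes term by
   term. *)
have : '[jone J - f, x ∘ x] = 0.
  by rewrite -jdot_self_adjoint !jmulE (jmulC x f) fx subrr jdot0l.
rewrite x2 jdot_sumr => /eqP.
rewrite psumr_eq0 => [/allP h|i _]; last first.
  by rewrite jdotZr mulr_ge0 ?sqr_ge0// idempotent_dot_ge0//; exact: idempotentC.
have {}h i : k i *: q i = (if q i == f then k i else 0) *: f.
  case: eqP => [-> //|qf]; rewrite scale0r.
  have [->|ki] := eqVneq (k i) 0; first by rewrite scale0r.
  have /eqP := h i (mem_index_enum _).
  rewrite jdotZr => /eqP; rewrite mulf_eq0 sqrf_eq0 (negbTE ki) /= => /eqP.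
  move=> /(idempotent_dot_eq0 (idempotentC ff) (qq i)) /eqP.
  rewrite !jmulE subr_eq0 => /eqP fq; case: fprim.
  exists (q i), (f - q i); split=> //.
  - by rewrite /jidempotent !jmulE (jmulC _ f) ff -fq qq; apply: jdot_inj => v; rewrite !jdotE; ring.
  - by case: (qp i).
  - by rewrite subr_eq0 eq_sym; apply/eqP.
  - by rewrite addrC subrK.
exists (\sum_i (if q i == f then k i else 0)).
by rewrite {1}xE scaler_suml; apply: eq_bigr => i _; rewrite h.
Qed.

Lemma primitive_peirce f x : jprimitive f -> exists u x0,
  [/\ x = ('[x, f] / '[f, f]) *: f + u + x0, f ∘ u = 2^-1 *: u & f ∘ x0 = 0].
Proof.
move=> fp; have ff := primitive_idempotent fp.
have [x1 [u [x0 [xE e1 eh e0]]]] := peirce_decomposition ff x.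
have [k x1E] := primitive_line fp e1.
exists u, x0; split=> //.
have -> : '[x, f] = k * '[f, f].
  rewrite xE x1E !jdotE.
  have : '[u, f] = 0.
    have := jdot_self_adjoint f u f; rewrite ff eh jdotZl; lra.
  have : '[x0, f] = 0.
    by rewrite -[X in '[_, X]]ff -jdot_self_adjoint e0 jdot0l.
  lra.
by rewrite mulfK ?gt_eqF ?primitive_dot_gt0// -x1E.
Qed.

Definition quad a x := 2%:R *: (a ∘ (a ∘ x)) - (a ∘ a) ∘ x.

(** On the Peirce space of eigenvalue c, [quad f] acts as 2 c^2 - c, that is 1 for c = 1 and 0 for c
    = 1/2 or 0: it projects onto the line of [f]. *)
Lemma quad_by_primitive f x : jprimitive f -> quad f x = ('[x, f] / '[f, f]) *: f.
Proof.
move=> fp; have ff := primitive_idempotent fp.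
have [u [x0 [xE eh e0]]] := primitive_peirce x fp.
rewrite {1}xE; set k := _ / _; apply: jdot_inj => v.
rewrite /quad !jmulE ff eh e0 !jmulE ff eh !jdotE; lra.
Qed.

(** Write a = k f + u + b in Peirce components and u^2 = nu f + c. Then quad a f = k^2 f + k u + c,
    whose square is k^2 + nu times itself; its component along [f] gives the first claim. *)
Lemma quad_of_primitive f a : jprimitive f ->
  '[quad a f, f] = ('[a, f] / '[f, f]) ^+ 2 * '[f, f] /\
  exists2 k, 0 <= k & quad a f ∘ quad a f = k *: quad a f.
Proof.
move=> fp; have ff := primitive_idempotent fp; have fgt0 := primitive_dot_gt0 fp.
have [u [b [aE fu fb]]] := primitive_peirce a fp.
set k := _ / _ in aE *.
have [v [c [uuE fv fc]]] := primitive_peirce (u ∘ u) fp.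
set nu := _ / _ in uuE.
have nu0 : 0 <= nu by rewrite divr_ge0 ?jdot_ge0// jdotC idempotent_dot_sqr_ge0.
have v0 : v = 0.
  have := peirce_half_sqr ff fu; rewrite uuE !jmulE ff fv fc !jmulE ff fv !addr0.
  move=> h; apply: jdot_inj => w; have := congr1 (jdot J ^~ w) h.
  rewrite !jdotE; lra.
rewrite v0 addr0 in uuE.
have bu : f ∘ (b ∘ u) = 2^-1 *: (b ∘ u) by rewrite peirce0_mul// fu jmulZr.
have bb : f ∘ (b ∘ b) = 0 by rewrite peirce0_mul// fb jmul0r.
have quadE : quad a f = k ^+ 2 *: f + k *: u + c.
  have uf : u ∘ f = 2^-1 *: u by rewrite jmulC.
  have bf : b ∘ f = 0 by rewrite jmulC.
  have buf : (b ∘ u) ∘ f = 2^-1 *: (b ∘ u) by rewrite jmulC.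
  have bbf : (b ∘ b) ∘ f = 0 by rewrite jmulC.
  have cf : c ∘ f = 0 by rewrite jmulC.
  rewrite /quad aE !jmulE (jmulC u b) !(ff, uf, fu, bf, fb, buf, bbf).
  rewrite !jmulE !(uf, fu, buf, bbf) uuE !jmulE ff cf.
  by apply: jdot_inj => w; rewrite !jdotE; lra.
(* The Jordan identity at [u] and [f] determines [u ∘ c]; at [u] and [u] it then determines
   [c ∘ c]. *)
have ucE : u ∘ c = (nu / 2) *: u.
  have := jmul_jordan u f; rewrite (jmulC u f) fu (jmulC (u ∘ u) f) uuE !jmulE ff fc.
  rewrite (jmulC u f) fu (jmulC c u) !jmulE => h.
  apply: jdot_inj => w; have := congr1 (jdot J ^~ w) h.
  rewrite !jdotE; lra.
have ccE : c ∘ c = nu *: c.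
  have := jmul_jordan u u; rewrite uuE !jmulE ff (jmulC c f) fc (jmulC c u) ucE.
  rewrite fu !jmulE uuE => h.
  apply: jdot_inj => w; have := congr1 (jdot J ^~ w) h.
  rewrite !jdotE; lra.
split.
  rewrite quadE !jdotE.
  have -> : '[u, f] = 0.
    have := jdot_self_adjoint f u f; rewrite ff fu jdotZl; lra.
  have -> : '[c, f] = 0.
    by rewrite -[X in '[_, X]]ff -jdot_self_adjoint fc jdot0l.
  by rewrite mulr0 !addr0.
exists (k ^+ 2 + nu); first by rewrite addr_ge0 ?sqr_ge0.
rewrite quadE !jmulE ff (jmulC u f) (jmulC c f) (jmulC c u) fu fc ucE ccE uuE.
by apply: jdot_inj => w; rewrite !jdotE; lra.
Qed.

(** If k > 0, [quad a f] is a positive multiple of its own square, and squares pair nonnegatively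
    with idempotents; if k = 0, it vanishes. *)
Lemma quad_dot_ge0 a f g : jprimitive f -> jidempotent g -> 0 <= '[quad a f, g].
Proof.
move=> fp gg; have [_ [k k0 e]] := quad_of_primitive a fp; move: e; set w := quad a f.
have [->|kn0 e] := eqVneq k 0.
  by rewrite scale0r => /jsqr_eq0->; rewrite jdot0l.
have -> : w = k^-1 *: (w ∘ w) by rewrite e scalerA mulVf// scale1r.
by rewrite jdotZl mulr_ge0 ?invr_ge0// jdotC idempotent_dot_sqr_ge0.
Qed.

(** Computing ['[quad e f, f]] by [quad_by_primitive] and by [quad_of_primitive] gives '[e, f]^2 /
    '[e, e] = '[e, f]^2 / '[f, f]. *)
Lemma primitive_norm_eq e f : jprimitive e -> jprimitive f -> '[e, f] != 0 ->
  '[e, e] = '[f, f].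
Proof.
move=> ep fp ef0; have [h _] := quad_of_primitive e fp.
have := primitive_dot_gt0 ep; have := primitive_dot_gt0 fp => f0 e0.
move: h; rewrite quad_by_primitive// jdotZl jdotC.
move: ef0 e0 f0; set x := '[e, f]; set y := '[e, e]; set z := '[f, f].
move=> x0 y0 z0 h.
have hx : x / y * x = (x / z) ^+ 2 * z by rewrite -h /x jdotC.
have : x / y = x / z.
  apply: (mulIf x0); rewrite hx expr2 -mulrA; congr (_ * _).
  by rewrite divfK// gt_eqF.
by move/(mulfI x0)/invr_inj.
Qed.

End Frames.

(** * A scalar inequality *)

Section PinskerScalar.
Variable R : realType.
Implicit Types t u a b : R.

(** With t = a / b, dividing the inequality of [relative_entropy_ge] by 2 a / 3 and expanding its
    left side in partial fractions turns it into [k 1 <= k t]. *)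
Let k t : R := ln t + 4^-1 * t^-1 + (27 / 4) * (t + 2)^-1.

Let is_derive_k t : 0 < t ->
  is_derive t 1 k ((t - 1) ^+ 3 / (t ^+ 2 * (t + 2) ^+ 2)).
Proof.
move=> t0; have t20 : t + 2 != 0 by rewrite gt_eqF// addr_gt0.
have tn0 : t != 0 by rewrite gt_eqF.
have h1 := is_derive1_ln t0.
have h2 : is_derive t 1 (fun x : R => x + 2) 1.
  by apply: is_derive_eq; rewrite addr0.
have h3 : is_derive t 1 (fun x : R => x^-1) (- t ^- 2).
  by rewrite -[- _]mulr1; exact: (@is_deriveV _ id).
have h4 : is_derive t 1 (fun x : R => (x + 2)^-1) (- (t + 2) ^- 2).
  by rewrite -[- _]mulr1; exact: (@is_deriveV _ (fun x : R => x + 2) _ _ _ t20 h2).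
have h5 := is_deriveD (is_deriveD h1 (is_deriveZ 4^-1 h3)) (is_deriveZ (27 / 4) h4).
rewrite (_ : _ / _ = t^-1 + 4^-1 *: (- t ^- 2) + (27 / 4) *: (- (t + 2) ^- 2)) //.
by rewrite /GRing.scale /=; field; rewrite tn0 t20.
Qed.

Let k_ge t : 0 < t -> k 1 <= k t.
Proof.
move=> t0.
have cont a b : 0 < a -> {within `[a, b], continuous k}%classic.
  move=> a0; apply: derivable_within_continuous => x; rewrite in_itv /= => /andP[ax _].
  by have [] := is_derive_k (lt_le_trans a0 ax).
have den x : 0 < x -> 0 < x ^+ 2 * (x + 2) ^+ 2.
  by move=> x0; rewrite mulr_gt0 ?exprn_gt0// addr_gt0.
have [t1|t1] := leP t 1.
- apply: (@ler0_derive1_nincr _ k t 1) => //; last exact: cont.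
  + by move=> x; rewrite in_itv /= => /andP[tx _]; have [] := is_derive_k (lt_trans t0 tx).
  + move=> x; rewrite in_itv /= => /andP[tx x1]; have x0 := lt_trans t0 tx.
    rewrite derive1E; have [_ ->] := is_derive_k x0.
    rewrite ler_pdivrMr ?den// mul0r exprS nmulr_rle0 ?subr_lt0//.
    by rewrite sqr_ge0.
- apply: (@ger0_derive1_ndecr _ k 1 t) => //; last 2 first.
  + exact: cont.
  + exact: ltW.
  + by move=> x; rewrite in_itv /= => /andP[tx _]; have [] := is_derive_k (lt_trans ltr01 tx).
  + move=> x; rewrite in_itv /= => /andP[tx x1]; have x0 := lt_trans ltr01 tx.
    rewrite derive1E; have [_ ->] := is_derive_k x0.
    by rewrite divr_ge0 ?exprn_ge0 ?subr_ge0 ?ltW// den.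
Qed.

(** The weight a + 2 b and the factor 2 / 3 make the two sides agree to third order at a = b, as the
    triple zero of the derivative of [k] at 1 shows. *)
Lemma relative_entropy_ge a b : 0 < a -> 0 < b ->
  (a - b) ^+ 2 / (a + 2 * b) <= (2 / 3) * (a * ln a - a * ln b + b - a).
Proof.
move=> a0 b0; have := k_ge (divr_gt0 a0 b0).
rewrite /k ln1 ln_div ?posrE// invr1 invf_div.
have ab : 0 < a + 2 * b by rewrite addr_gt0// mulr_gt0.
have -> : (a / b + 2)^-1 = b / (a + 2 * b).
  by field; rewrite !gt_eqF//.
rewrite -(ler_pM2l a0) => h.
have e : (a - b) ^+ 2 / (a + 2 * b) = 
    (2 / 3) * (a * (0 + 4^-1 * 1 + 27 / 4 * (1 + 2)^-1 - 4^-1 * (b / a)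
      - 27 / 4 * (b / (a + 2 * b))) + b - a).
  by field; rewrite !gt_eqF.
rewrite e; lra.
Qed.

End PinskerScalar.

(** * Rank and trace *)

Section Trace.
Variables (R : realType) (J : eja R).
Implicit Types (x y z w p q e f g a s : J) (n m : nat) (k : R).

Lemma primitive_dot1 p : jprimitive p -> '[p, jone J] = '[p, p].
Proof. by move/primitive_idempotent/idempotent_dot_self. Qed.

(** The sum of '[q i, p j] / '[q i, q i] over all i and j is n. By [primitive_norm_eq] the quotient
    is symmetric in the two idempotents, so the sum is also m. *)
Lemma frame_size n m (q : 'I_n -> J) (p : 'I_m -> J) :
  frame q -> frame p -> n = m.
Proof.
move=> [qp _ q1] [pp _ p1].
have D (e f : J) : jprimitive e -> jprimitive f -> '[e, f] / '[e, e] = '[f, e] / '[f, f].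
  move=> ep fp; rewrite jdotC; have [->|ef] := eqVneq '[f, e] 0.
    by rewrite !mul0r.
  by rewrite (primitive_norm_eq fp ep ef).
have S (k l : nat) (u : 'I_k -> J) (v : 'I_l -> J) : (forall i, jprimitive (u i)) ->
    \sum_i v i = jone J -> \sum_i \sum_j '[u i, v j] / '[u i, u i] = k%:R.
  move=> up v1; rewrite -[in RHS](card_ord k) -sum1_card natr_sum.
  apply: eq_bigr => i _.
  rewrite -mulr_suml -jdot_sumr v1 primitive_dot1// divff//.
  by rewrite gt_eqF ?primitive_dot_gt0.
apply/eqP; rewrite -(eqr_nat R) -(S _ _ q p)// -(S _ _ p q)// exchange_big /=.
by apply/eqP; apply: eq_bigr => j _; apply: eq_bigr => i _; rewrite D.
Qed.

Lemma frame_mul n (q : 'I_n -> J) (k l : 'I_n -> R) : frame q ->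
  (\sum_i k i *: q i) ∘ (\sum_i l i *: q i) = \sum_i (k i * l i) *: q i.
Proof.
move=> [qp qo _]; rewrite jmul_suml; apply: eq_bigr => i _.
rewrite jmulZl orthogonal_family_mul ?scalerA// => j.
exact: primitive_idempotent.
Qed.

Lemma frame_jhorner n (q : 'I_n -> J) (k : 'I_n -> R) (f : {poly R}) : frame q ->
  jhorner f (\sum_i k i *: q i) = \sum_i f.[k i] *: q i.
Proof.
move=> qf; have pE d : jpow (\sum_i k i *: q i) d = \sum_i k i ^+ d *: q i.
  elim: d => [|d ih].
    by case: qf => _ _ q1; rewrite /jpow /= -q1; apply: eq_bigr => i _; rewrite scale1r.
  by rewrite jpowS ih frame_mul//; apply: eq_bigr => i _; rewrite exprS.
rewrite /jhorner; under eq_bigr do rewrite pE scaler_sumr.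
rewrite exchange_big /=; apply: eq_bigr => i _.
by rewrite horner_coef scaler_suml; apply: eq_bigr => j _; rewrite scalerA.
Qed.

Lemma frame_comb_eq0 n (q : 'I_n -> J) (k : 'I_n -> R) : frame q ->
  \sum_i k i *: q i = 0 -> forall i, k i = 0.
Proof.
move=> [qp qo q1] k0 i.
have := orthogonal_family_mul k i (fun j => primitive_idempotent (qp j)) qo.
rewrite k0 jmul0r => /esym/eqP; rewrite scaler_eq0 => /orP[/eqP//|].
by have [_ /negbTE->] := qp i.
Qed.

(** Every element is annihilated by a product of n linear factors, one for each member of a frame,
    which bounds the degree of its minimal polynomial. *)
Lemma jrank_frame n (q : 'I_n -> J) : frame q -> jrank J = n.
Proof.
move=> qf.
have ann m (p : 'I_m -> J) (k : 'I_m -> R) : frame p ->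
    jhorner (\prod_i ('X - (k i)%:P)) (\sum_i k i *: p i) = 0.
  move=> pf; rewrite frame_jhorner// big1// => i _.
  by rewrite horner_prod (bigD1 i)//= !hornerE subrr mul0r scale0r.
have szm m (k : 'I_m -> R) : size (\prod_i ('X - (k i)%:P)) = m.+1.
  by rewrite size_prod_XsubC /index_enum -enumT size_enum_ord.
have mon m (k : 'I_m -> R) : \prod_i ('X - (k i)%:P) \is monic by exact: monic_prod_XsubC.
have rn : is_jrank J n.
  split; last first.
    move=> x f [fm fx fmin]; have [m [k [p [pf xE]]]] := spectral_theorem x.
    rewrite (frame_size qf pf); have := fmin _ (mon m k).
    by rewrite szm {1}xE ann//; case: (size f) => // d; apply.
  (* With distinct coefficients any annihilator has n distinct roots, so the bound is attained. *)
  pose k (i : 'I_n) : R := i%:R.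
  exists (\sum_i k i *: q i), (\prod_i ('X - (k i)%:P)); split; last by rewrite szm.
  split=> [||g gm]; [exact: mon|exact: ann|rewrite frame_jhorner// szm].
  move=> /(frame_comb_eq0 qf) g0.
  have := @max_poly_roots R g (codom k) (monic_neq0 gm).
  rewrite size_codom card_ord; apply.
    by apply/allP => _ /codomP[i ->]; rewrite rootE g0.
  rewrite map_inj_uniq ?enum_uniq// => i j /eqP; rewrite eqr_nat => /eqP.
  exact: val_inj.
apply: xget_unique => // r [[x [f [fm fr]]] rmax].
case: rn => -[y [g [gm gn]]] nmax; apply/eqP; rewrite eqn_leq.
by apply/andP; split; [rewrite -fr; exact: nmax fm|rewrite -gn; exact: rmax gm].
Qed.

Lemma jspectralP x : is_spectral x (jspectral x).
Proof.
apply: xgetPex; have [n [k [q [qf xE]]]] := spectral_theorem x.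
(* The frame is indexed by ['I_n]; eliminating the equation replaces [n] by [jrank J] in its
   type. *)
have rn := jrank_frame qf; case: _ / rn in k q qf xE *.
exists ([ffun i => k i], [ffun i => q i]); case: qf => qp qo q1; split=> /=.
  split=> [i|i j ij|]; rewrite ?ffunE ?qo//.
  by rewrite -q1; apply: eq_bigr => i _; rewrite ffunE.
by rewrite {1}xE; apply: eq_bigr => i _; rewrite !ffunE.
Qed.

Lemma jframe_frame x : frame (jframe x).
Proof. by case: (jspectralP x). Qed.

Lemma jeig_jframe x : x = \sum_i jeig x i *: jframe x i.
Proof. by case: (jspectralP x). Qed.

(* Represents the trace with respect to the given inner product: see [jtrE]. *)
Definition jtr_rep : J :=
  \sum_i '[jframe (jone J) i, jframe (jone J) i]^-1 *: jframe (jone J) i.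
Local Notation h := jtr_rep.

(** Expand [f] over the frame defining [h]: the members orthogonal to [f] contribute 0, and the
    others have the norm of [f] by [primitive_norm_eq]. *)
Lemma jtr_rep_primitive f : jprimitive f -> h ∘ f = '[f, f]^-1 *: f.
Proof.
move=> fp; have [qp _ q1] := jframe_frame (jone J).
rewrite /h; set q := jframe _ in qp q1 *.
have fE : f = \sum_i q i ∘ f by rewrite -jmul_suml q1 jmul1x.
rewrite [X in _ = _ *: X]fE jmul_suml scaler_sumr; apply: eq_bigr => i _.
rewrite jmulZl; have [|e] := eqVneq '[q i, f] 0.
  move/(idempotent_dot_eq0 (primitive_idempotent (qp i)) (primitive_idempotent fp)).
  by move->; rewrite !scaler0.
by rewrite (primitive_norm_eq (qp i) fp e).
Qed.

Lemma jtr_rep_dot f : jprimitive f -> '[h, f] = 1.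
Proof.
move=> fp; rewrite -[f in LHS]jmulx1 -jdot_self_adjoint jmulC jtr_rep_primitive//.
by rewrite jdotZl primitive_dot1// mulVf// gt_eqF ?primitive_dot_gt0.
Qed.

(** This makes the trace linear, which its definition through a chosen spectral decomposition does
    not show. *)
Lemma jtrE x : jtr x = '[h, x].
Proof.
rewrite {2}(jeig_jframe x) jdot_sumr; apply: eq_bigr => i _.
by have [qp _ _] := jframe_frame x; rewrite jdotZr jtr_rep_dot// mulr1.
Qed.

Lemma primitive_span (P : J -> Prop) :
  P 0 -> (forall x y, P x -> P y -> P (x + y)) ->
  (forall k f, jprimitive f -> P (k *: f)) -> forall x, P x.
Proof.
move=> P0 PD Pf x; rewrite (jeig_jframe x); have [qp _ _] := jframe_frame x.
by apply: big_ind => // i _; apply: Pf.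
Qed.

(* By [primitive_norm_eq], either f ∘ g = 0 or h acts on f and g by the same scalar. *)
Lemma jtr_rep_central x y : h ∘ (x ∘ y) = x ∘ (h ∘ y).
Proof.
apply: jdot_inj => z; move: x y z.
apply: primitive_span => [y z|x x' hx hx' y z|k e ep].
- by rewrite !jmulE !jdotE.
- by rewrite !jmulE !jdotE hx hx'.
apply: primitive_span => [z|x x' hx hx' z|k' f fp].
- by rewrite !jmulE !jdotE.
- by move: (hx z) (hx' z); rewrite !jmulE !jdotE !mulrDr => -> ->.
apply: primitive_span => [|x x' hx hx'|k'' g gp].
- by rewrite !jdotE.
- by rewrite !(jdotDr, hx, hx').
rewrite !jmulE !jdotE !(jdot_self_adjoint h) !jtr_rep_primitive// !jmulE !jdotE.
have [fg|fg] := eqVneq '[f, g] 0; last by rewrite (primitive_norm_eq fp gp fg).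
have -> : '[e ∘ f, g] = 0; last by rewrite !mulr0.
rewrite jmulC jdot_self_adjoint.
rewrite (idempotent_dot_eq0 (primitive_idempotent fp) (primitive_idempotent gp) fg).
by rewrite jdot0r.
Qed.

Lemma jtr_jmul x y : jtr (x ∘ y) = '[h ∘ x, y].
Proof. by rewrite jtrE (jmulC h) jdot_self_adjoint. Qed.

Lemma jtr_assoc x y z : jtr ((x ∘ y) ∘ z) = jtr (y ∘ (x ∘ z)).
Proof. by rewrite !jtr_jmul jtr_rep_central jdot_self_adjoint. Qed.

Lemma jtr_jmul_primitive x f : jprimitive f -> jtr (x ∘ f) = '[x, f] / '[f, f].
Proof.
by move=> fp; rewrite jmulC jtr_jmul jtr_rep_primitive// jdotZl jdotC mulrC.
Qed.

Lemma jtrD x y : jtr (x + y) = jtr x + jtr y.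
Proof. by rewrite !jtrE jdotDr. Qed.
Lemma jtrN x : jtr (- x) = - jtr x.
Proof. by rewrite !jtrE jdotNr. Qed.
Lemma jtrZ k x : jtr (k *: x) = k * jtr x.
Proof. by rewrite !jtrE jdotZr. Qed.
Lemma jtr_sum (I : Type) (r : seq I) (P : pred I) (F : I -> J) :
  jtr (\sum_(i <- r | P i) F i) = \sum_(i <- r | P i) jtr (F i).
Proof. by rewrite jtrE jdot_sumr; apply: eq_bigr => i _; rewrite jtrE. Qed.
Lemma jtr_primitive f : jprimitive f -> jtr f = 1.
Proof. by rewrite jtrE; apply: jtr_rep_dot. Qed.

Lemma jeig_gt0 x i : jinterior (@jcone R J) x -> 0 < jeig x i.
Proof.
move=> [eps eps0 hK]; have [qp qo _] := jframe_frame x.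
set e := jframe x i; have ep : jprimitive e by exact: qp.
have ee0 := primitive_dot_gt0 ep.
set E := '[e, e] in ee0 *; have sE : 0 < Num.sqrt E by rewrite sqrtr_gt0.
(* The displacement [d *: e] has norm eps / 2; pairing the displaced point with [e] will give
   [d <= jeig x i]. *)
pose d := eps / (2 * Num.sqrt E).
have d0 : 0 < d by rewrite divr_gt0// mulr_gt0.
have [] := hK (x - d *: e).
  rewrite addrAC subrr add0r !jdotE opprK mulrA -expr2 sqrtrM ?sqr_ge0//.
  rewrite sqrtr_sqr gtr0_norm// /d -/E invfM mulrA mulfVK ?gt_eqF//.
  lra.
move=> w _ wE; have : 0 <= '[e, x - d *: e].
  by rewrite -wE idempotent_dot_sqr_ge0//; exact: primitive_idempotent.
have eigE : '[e, x] = jeig x i * E.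
  rewrite -[e in LHS](primitive_idempotent ep) jdot_self_adjoint {1}(jeig_jframe x).
  rewrite orthogonal_family_mul ?jdotZr// => j.
  exact: primitive_idempotent.
rewrite !jdotE eigE -/E -mulrBl pmulr_lge0// => h0.
by rewrite (lt_le_trans d0)// -subr_ge0.
Qed.

End Trace.

(** * Pinsker's inequality *)

Section PinskerInequality.
Variables (R : realType) (J : eja R).
Implicit Types (x y z e f s : J) (t d k : R).

Lemma quad_shift s t d e : quad (t *: s + d *: jone J) e =
  t ^+ 2 *: quad s e + (2 * t * d) *: (s ∘ e) + d ^+ 2 *: e.
Proof.
apply: jdot_inj => v; rewrite /quad !jmulE !jdotE; ring.
Qed.

(* Plays the role of the Cauchy-Schwarz inequality for a |-> tr (quad a e ∘ f) on the
   span of s and 1. *)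
Lemma quad_shift_jtr_ge0 s t d e f : jprimitive e -> jprimitive f ->
  0 <= t ^+ 2 * jtr (quad s e ∘ f) + 2 * t * d * jtr ((s ∘ e) ∘ f) + d ^+ 2 * jtr (e ∘ f).
Proof.
move=> ep fp.
have -> : t ^+ 2 * jtr (quad s e ∘ f) + 2 * t * d * jtr ((s ∘ e) ∘ f) +
    d ^+ 2 * jtr (e ∘ f) = jtr (quad (t *: s + d *: jone J) e ∘ f).
  by rewrite quad_shift; move: (quad s e) => w; rewrite !jmulE !jtrD !jtrZ.
rewrite jtr_jmul_primitive// divr_ge0 ?jdot_ge0// quad_dot_ge0//.
exact: primitive_idempotent.
Qed.

Lemma jtr_quad s x : s ∘ s = jone J -> jtr (quad s x) = jtr x.
Proof.
by move=> ss; rewrite /quad jtrD jtrN jtrZ -jtr_assoc ss !jmulE; ring.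
Qed.

Lemma quad1 s : s ∘ s = jone J -> quad s (jone J) = jone J.
Proof.
by move=> ss; apply: jdot_inj => v; rewrite /quad !jmulE ss !jdotE; ring.
Qed.

Lemma quad_sum s n (k : 'I_n -> R) (q : 'I_n -> J) :
  quad s (\sum_i k i *: q i) = \sum_i k i *: quad s (q i).
Proof.
rewrite /quad !jmul_sumr scaler_sumr -sumrB; apply: eq_bigr => i _.
by rewrite !jmulE scalerBr !scalerA mulrC.
Qed.

Lemma jnorm1_dual z : exists2 s, s ∘ s = jone J & jnorm1 z = jtr (s ∘ z).
Proof.
have qf := jframe_frame z; have [qp _ q1] := qf.
(* The sign is 1 at 0, so that all signs square to 1 and [s ∘ s] is the identity. *)
pose sg i : R := if 0 <= jeig z i then 1 else -1.
exists (\sum_i sg i *: jframe z i).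
  rewrite frame_mul// -[RHS]q1; apply: eq_bigr => i _.
  by rewrite /sg; case: ifP; rewrite ?mulrNN mulr1 scale1r.
rewrite [X in _ ∘ X](jeig_jframe z) frame_mul// jtr_sum; apply: eq_bigr => i _.
rewrite jtrZ jtr_primitive// mulr1 /sg; case: ifP => [/ger0_norm->|].
  by rewrite mul1r.
by move/negbT; rewrite -ltNge => /ltr0_norm->; rewrite mulN1r.
Qed.

End PinskerInequality.

Theorem theorem7 (R : realType) (J : eja R) (x y : J)
  (hx : jsimplex_int x) (hy : jsimplex_int y) :
  jentropy_div x y >= 2^-1 * jnorm1 (x - y) ^+ 2.
Proof.
have [[_ x1] xint] := hx; have [[_ y1] yint] := hy.
have [s ss nE] := jnorm1_dual (x - y); set N := jnorm1 _ in nE *.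
have ef := jframe_frame x; have ff := jframe_frame y.
have [ep _ e1] := ef; have [fp _ f1] := ff.
have X0 i := jeig_gt0 i xint; have Y0 j := jeig_gt0 j yint.
have xE := jeig_jframe x; have yE := jeig_jframe y.
set X := jeig x in X0 xE; set Y := jeig y in Y0 yE.
set e := jframe x in ep e1 ef xE; set f := jframe y in fp f1 ff yE.
(* All traces involved are double sums against tr (M e_i ∘ f_j), with [M] the identity,
   multiplication by [s], or [quad s]; linearity of [M] collapses them in [SE]. *)
pose S (M : J -> J) (a b : 'I_(jrank J) -> R) :=
  \sum_(p : 'I_(jrank J) * 'I_(jrank J)) a p.1 * b p.2 * jtr (M (e p.1) ∘ f p.2).
have SE M a b : (forall k : 'I_(jrank J) -> R, M (\sum_i k i *: e i) = \sum_i k i *: M (e i)) ->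
    S M a b = jtr (M (\sum_i a i *: e i) ∘ (\sum_j b j *: f j)).
  move=> ->; rewrite /S -(pair_bigA _ (fun i j => a i * b j * jtr (M (e i) ∘ f j))) /=.
  rewrite jmul_suml jtr_sum; apply: eq_bigr => i _.
  rewrite jmul_sumr jtr_sum; apply: eq_bigr => j _.
  by rewrite jmulZl jmulZr !jtrZ mulrA.
pose one (i : 'I_(jrank J)) : R := 1.
have one_e : \sum_i one i *: e i = jone J.
  by rewrite -e1; apply: eq_bigr => i _; rewrite scale1r.
have one_f : \sum_i one i *: f i = jone J.
  by rewrite -f1; apply: eq_bigr => i _; rewrite scale1r.
have idM (k : 'I_(jrank J) -> R) : id (\sum_i k i *: e i) = \sum_i k i *: id (e i) by [].
have sM (k : 'I_(jrank J) -> R) : jmul J s (\sum_i k i *: e i) = \sum_i k i *: jmul J s (e i).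
  by rewrite jmul_sumr; apply: eq_bigr => i _; rewrite jmulZr.
have qM (k : 'I_(jrank J) -> R) := quad_sum s k e.
pose lX i := ln (X i); pose lY j := ln (Y j).
have DE : jentropy_div x y =
    S id (fun i => X i * lX i) one - S id X lY + S id one Y - S id X one.
  rewrite !SE// one_e one_f -xE -yE !jmulE -frame_mul// -xE.
  by rewrite /jentropy_div !(jtrD, jtrN).
(* Both trace conditions enter here: the weights X i + 2 Y j give the total tr x + 2 tr y = 3. *)
have QE : S (quad s) X one + 2 * S (quad s) one Y = 3.
  rewrite !SE// one_e one_f -xE -yE quad1// !jmulE jtr_quad// x1 y1; lra.
have NE : S (jmul J s) X one - S (jmul J s) one Y = N.
  by rewrite !SE// one_e one_f -xE -yE !jmulE nE !jmulE jtrD jtrN.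
(* Each term is at least X i + 2 Y j times the nonnegative form at t = - N / 3; the scalar
   inequality accounts for the difference. *)
have : 0 <= \sum_(p : 'I_(jrank J) * 'I_(jrank J))
    ((N / 3) ^+ 2 * (X p.1 + 2 * Y p.2) * jtr (quad s (e p.1) ∘ f p.2)
     - 2 * (N / 3) * (X p.1 - Y p.2) * jtr (s ∘ e p.1 ∘ f p.2)
     + 2 / 3 * (X p.1 * lX p.1 - X p.1 * lY p.2 + Y p.2 - X p.1) * jtr (e p.1 ∘ f p.2)).
  apply: sumr_ge0 => -[i j] _ /=.
  have w0 : 0 < X i + 2 * Y j by rewrite addr_gt0// mulr_gt0.
  have B0 : 0 <= jtr (e i ∘ f j).
    have := quad_shift_jtr_ge0 s 0 1 (ep i) (fp j).
    by rewrite expr0n mulr0 !mul0r !add0r expr1n mul1r.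
  have := quad_shift_jtr_ge0 s (- (N / 3)) ((X i - Y j) / (X i + 2 * Y j)) (ep i) (fp j).
  move=> /(mulr_ge0 (ltW w0)) /le_trans; apply.
  have := ler_wpM2r B0 (relative_entropy_ge (X0 i) (Y0 j)).
  rewrite -/(lX i) -/(lY j) => h.
  rewrite -subr_ge0; rewrite -subr_ge0 in h; apply: (le_trans h).
  rewrite le_eqVlt; apply/orP; left; apply/eqP. field.
  by rewrite gt_eqF.
have -> : \sum_(p : 'I_(jrank J) * 'I_(jrank J))
    ((N / 3) ^+ 2 * (X p.1 + 2 * Y p.2) * jtr (quad s (e p.1) ∘ f p.2)
     - 2 * (N / 3) * (X p.1 - Y p.2) * jtr (s ∘ e p.1 ∘ f p.2)
     + 2 / 3 * (X p.1 * lX p.1 - X p.1 * lY p.2 + Y p.2 - X p.1) * jtr (e p.1 ∘ f p.2))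
  = (N / 3) ^+ 2 * (S (quad s) X one + 2 * S (quad s) one Y)
    - 2 * (N / 3) * (S (jmul J s) X one - S (jmul J s) one Y) + 2 / 3 * jentropy_div x y.
  rewrite DE /S -!sumrN !mulr_sumr -!big_split /= !mulr_sumr -!sumrN -!big_split /=.
  by apply: eq_bigr => p _; rewrite /one; ring.
(* What remains is 0 <= N^2 / 3 - 2 N^2 / 3 + 2 D / 3, with D the divergence. *)
rewrite QE NE; lra.
Qed.
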